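(* Assume [A1] (see context) and let $\eta=\frac12\log\frac{2L+1}{2L}$. Then, for any given $x_0\in\mathbb R^d$, the inner target distribution $$p^{\leftarrow}(z|x_0)\propto e^{-g(z)},\qquad g(z)=f_{(K-k-1)\eta}(z)+\frac{\|x_0-z\cdot e^{-\eta}\|^2}{2(1-e^{-2\eta})},$$ is $L$-strongly log-concave and $3L$-smooth, i.e. $g$ is $L$-strongly convex and $\nabla g$ is $3L$-Lipschitz.
   Context: $p_*\propto e^{-f_*}$ on $\mathbb R^d$; $d\mathbf x_t=-\mathbf x_t\,dt+\sqrt2\,dB_t$, $\mathbf x_0\sim p_*$; $p_t\propto e^{-f_t}$ is the density of $\mathbf x_t$. [A1]: for all $t\ge0$, the score $\nabla\log p_t$ is $L$-Lipschitz. $K\ge1$ and $k\in\{0,\dots,K-1\}$ are arbitrary fixed integers. *)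

(* Defs.v *)
From HB Require Import structures.
From mathcomp Require Import all_boot all_order all_algebra.
From mathcomp Require Import all_classical all_reals all_analysis.
Set Implicit Arguments.
Unset Strict Implicit.
Unset Printing Implicit Defensive.
Import Order.TTheory GRing.Theory Num.Theory.
Import numFieldNormedType.Exports.
Local Open Scope classical_set_scope.
Local Open Scope ring_scope.

Section measurable_rV.
Context {d} {T : sigmaRingType d}.
Variable n : nat.

Let coors : 'I_n -> 'rV[T]_n -> T := fun i x => x ord0 i.

Let rV_set0 : g_sigma_preimage coors set0.
Proof. exact: sigma_algebra0. Qed.

Let rV_setC A : g_sigma_preimage coors A -> g_sigma_preimage coors (~` A).
Proof. exact: sigma_algebraC. Qed.

Let rV_bigcup (F : _^nat) : (forall i, g_sigma_preimage coors (F i)) ->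
  g_sigma_preimage coors (\bigcup_i (F i)).
Proof. exact: sigma_algebra_bigcup. Qed.

(* Product sigma-algebra, generated by the coordinate maps; for T = R it is
   the Borel sigma-algebra of R^n. *)
HB.instance Definition _ := @isMeasurable.Build (measure_tuple_display d)
  'rV[T]_n (g_sigma_preimage coors) rV_set0 rV_setC rV_bigcup.

End measurable_rV.

Lemma measurable_rV_coord d (T : sigmaRingType d) n (i : 'I_n) :
  measurable_fun [set: 'rV[T]_n] (fun x : 'rV[T]_n => x ord0 i).
Proof.
move=> _ Y mY; rewrite setTI; apply: sub_sigma_algebra => /=.
rewrite -bigcup_seq/=; exists i => /=; first by rewrite mem_index_enum.
by exists Y => //; rewrite setTI.
Qed.

Lemma measurable_fun_rVP d1 d2 (T1 : measurableType d1)
    (T2 : measurableType d2) n (f : T1 -> 'rV[T2]_n) :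
  (forall i, measurable_fun [set: T1] (fun x => f x ord0 i)) ->
  measurable_fun [set: T1] f.
Proof.
move=> mf.
have mf' : g_sigma_preimage (fun i (x : 'rV[T2]_n) => x ord0 i) `<=`
    [set A | d1.-measurable (f @^-1` A)].
  apply: smallest_sub.
    split => /=.
    - by rewrite preimage_set0.
    - by move=> A mA; rewrite setTD preimage_setC; exact: measurableC.
    - by move=> F mF; rewrite preimage_bigcup; exact: bigcup_measurable.
  rewrite -bigcup_seq => A [i _] [B mB <-]/=.
  by rewrite setTI; have := mf i measurableT B mB; rewrite setTI.
by move=> _ A mA; rewrite setTI; exact: mf'.
Qed.

Section lebesgue_measure_rV.
Context (R : realType).

Definition consrV n (u : 'rV[R]_n * R) : 'rV[R]_(1 + n) := row_mx u.2%:M u.1.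

Lemma consrV0 n (u : 'rV[R]_n * R) : consrV u ord0 (ord0 : 'I_n.+1) = u.2.
Proof.
have -> : (ord0 : 'I_n.+1) = lshift n (ord0 : 'I_1) by exact: val_inj.
by rewrite /consrV row_mxEl mxE.
Qed.

Lemma consrVS n (u : 'rV[R]_n * R) (i : 'I_n) :
  consrV u ord0 (lift ord0 i : 'I_n.+1) = u.1 ord0 i.
Proof.
have -> : (lift ord0 i : 'I_n.+1) = rshift 1 i by exact: val_inj.
by rewrite /consrV row_mxEr.
Qed.

Lemma measurable_consrV n : measurable_fun [set: 'rV[R]_n * R] (@consrV n).
Proof.
apply: measurable_fun_rVP => i; case: (split_ordP i) => j ->.
  rewrite (_ : (fun _ => _) = snd); first exact: measurable_snd.
  by apply/funext => u; rewrite /consrV row_mxEl mxE (ord1 j).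
rewrite (_ : (fun _ => _) = (fun x : 'rV[R]_n => x ord0 j) \o fst).
  by apply: measurableT_comp => //; exact: measurable_rV_coord.
by apply/funext => u; rewrite /consrV row_mxEr.
Qed.

Definition lebesgue_rV_succ n (mu : {measure set 'rV[R]_n -> \bar R}) :=
  pushforward (mu \x lebesgue_measure)%E (@consrV n).

Section lebesgue_rV_succ_measure.
Variables (n : nat) (mu : {measure set 'rV[R]_n -> \bar R}).
Let nu := lebesgue_rV_succ mu.

Let nu0 : nu set0 = 0%E.
Proof.
by rewrite /nu /lebesgue_rV_succ /pushforward preimage_set0 measure0. Qed.

Let nu_ge0 A : (0 <= nu A)%E.
Proof. exact: (@measure_ge0 _ _ _ (mu \x lebesgue_measure)%E). Qed.

Let nu_sigma_additive : semi_sigma_additive nu.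
Proof.
move=> U mU tU mUU; rewrite /nu /lebesgue_rV_succ /pushforward.
rewrite preimage_bigcup; apply: measure_semi_sigma_additive.
- by move=> i; rewrite -[X in measurable X]setTI; exact: measurable_consrV.
- apply/trivIsetP => /= i j _ _ ij; rewrite -preimage_setI.
  by move/trivIsetP : tU => /(_ _ _ _ _ ij) ->//; rewrite preimage_set0.
- rewrite -preimage_bigcup -[X in measurable X]setTI.
  exact: measurable_consrV.
Qed.

HB.instance Definition _ := isMeasure.Build _ _ _ nu
  nu0 nu_ge0 nu_sigma_additive.

End lebesgue_rV_succ_measure.

Fixpoint lebesgue_measure_rV n : {measure set 'rV[R]_n -> \bar R} :=
  match n return {measure set 'rV[R]_n -> \bar R} with
  | 0%N => \d_(0 : 'rV[R]_0)
  | m.+1 => lebesgue_rV_succ (lebesgue_measure_rV m)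
  end.

Lemma lebesgue_measure_rV_box n (A : 'I_n -> set R) :
  (forall i, measurable (A i)) ->
  lebesgue_measure_rV n [set x | forall i, A i (x ord0 i)] =
  (\prod_(i < n) lebesgue_measure (A i))%E.
Proof.
elim: n A => [|n IHn] A mA.
  rewrite big_ord0 /= diracE mem_set//= => -[//].
rewrite big_ord_recl /= /lebesgue_rV_succ /pushforward.
have -> : @consrV n @^-1` [set x | forall i, A i (x ord0 i)] =
    [set x : 'rV[R]_n | forall i, A (lift ord0 i) (x ord0 i)] `*` A ord0.
  apply/seteqP; split => -[x a] /=.
  - move=> H; split => [i|]; first by rewrite -(consrVS (x, a)); exact: H.
    by rewrite -[a](consrV0 (x, a)); exact: H.
  - move=> [H0 H1] i; case: (unliftP ord0 i) => [j|] ->.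
      by rewrite consrVS; exact: H0.
    by rewrite consrV0.
rewrite product_measure1E//;
  [by rewrite -IHn// muleC | | exact: mA].
rewrite (_ : mkset _ = \bigcap_(i in [set: 'I_n])
    ((fun x : 'rV[R]_n => x ord0 i) @^-1` A (lift ord0 i))); last first.
  apply/seteqP; split => x /= H i; [move=> _; exact: H | exact: (H i Logic.I)].
apply: fin_bigcap_measurable => // i _.
by rewrite -[X in measurable X]setTI; exact: measurable_rV_coord.
Qed.

End lebesgue_measure_rV.

Section euclidean.
Context {R : realType} {n : nat}.
Implicit Types (x y v : 'rV[R]_n) (f p : 'rV[R]_n -> R).

(* The library norm `|x| on 'rV[R]_n is the sup norm. *)
Definition norm2 v : R := Num.sqrt (\sum_i v ord0 i ^+ 2).

Definition grad f x : 'rV[R]_n := \row_i 'D_(delta_mx 0 i) f x.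

Definition lipschitz2 (L : R) (F : 'rV[R]_n -> 'rV[R]_n) : Prop :=
  forall x y, norm2 (F x - F y) <= L * norm2 (x - y).

Definition smooth (L : R) f : Prop :=
  (forall x, differentiable f x) /\ lipschitz2 L (grad f).

Definition strongly_convex (m : R) f : Prop :=
  forall x y (a : R), 0 <= a <= 1 ->
  f (a *: x + (1 - a) *: y) <=
    a * f x + (1 - a) * f y - m / 2 * a * (1 - a) * norm2 (x - y) ^+ 2.

Definition propto_exp p f : Prop :=
  exists2 c : R, 0 < c & forall x, p x = c * expR (- f x).

Definition score p : 'rV[R]_n -> 'rV[R]_n := grad (fun x => ln (p x)).

Definition score_lipschitz (L : R) p : Prop :=
  (forall x, differentiable (fun x => ln (p x)) x) /\ lipschitz2 L (score p).

Definition strongly_log_concave (m : R) p : Prop :=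
  (forall x, 0 < p x) /\ strongly_convex m (fun x => - ln (p x)).

Definition log_smooth (L : R) p : Prop :=
  (forall x, 0 < p x) /\ smooth L (fun x => - ln (p x)).

(* If e^{-f} is not integrable, or has zero integral, this is the zero
   function, so that strong log-concavity of [gibbs f] rules out both cases. *)
Definition gibbs f x : R :=
  expR (- f x) /
  \int[lebesgue_measure_rV R n]_(y in [set: 'rV[R]_n]) expR (- f y).

End euclidean.

Section processes.
Context {disp : measure_display} {Omega : measurableType disp} {R : realType}.
Context (P : probability Omega R) {n : nat}.
Implicit Types (F : R -> set (set Omega)) (X B : R -> Omega -> 'rV[R]_n).

Definition has_density (Y : Omega -> 'rV[R]_n) (p : 'rV[R]_n -> R) : Prop :=
  [/\ measurable_fun [set: Omega] Y,
      measurable_fun [set: 'rV[R]_n] p,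
      (forall x, 0 <= p x) &
      forall A, measurable A ->
        P (Y @^-1` A) = (\int[lebesgue_measure_rV R n]_(x in A) (p x)%:E)%E].

Definition filtration F : Prop :=
  (forall t, 0 <= t -> sigma_algebra [set: Omega] (F t) /\
                       F t `<=` measurable) /\
  (forall s t, 0 <= s <= t -> F s `<=` F t).

Definition adapted F X : Prop :=
  forall t, 0 <= t -> forall A, measurable A -> F t (X t @^-1` A).

Definition continuous_paths X : Prop :=
  {ae P, forall w,
    {within [set t : R | 0 <= t], continuous (fun t => X t w)}}.

(* Standard n-dimensional F-Brownian motion: B_t - B_s is independent of F_s
   and has independent N(0, t - s) coordinates (the second argument of
   [normal_prob] is the standard deviation). *)
Definition brownian_motion F B : Prop :=
  [/\ adapted F B,
      {ae P, forall w, B 0 w = 0},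
      continuous_paths B &
      forall s t, 0 <= s < t ->
      forall E, F s E -> forall A : 'I_n -> set R, (forall i, measurable (A i)) ->
        P (E `&` [set w | forall i, A i ((B t w - B s w) ord0 i)]) =
        (P E * \prod_(i < n) normal_prob 0 (Num.sqrt (t - s)) (A i))%E].

(* dX_t = - X_t dt + sqrt 2 dB_t. The noise is additive, so the equation in
   integral form is pathwise and involves no stochastic integral. X_0 is
   F_0-measurable, hence independent of B. *)
Definition ornstein_uhlenbeck F B X : Prop :=
  [/\ filtration F, brownian_motion F B, adapted F X, continuous_paths X &
      {ae P, forall w, forall t, 0 <= t -> forall i,
        X t w ord0 i = X 0 w ord0 i
          - \int[lebesgue_measure]_(s in `[0, t]) X s w ord0 i
          + Num.sqrt 2 * B t w ord0 i}].

End processes.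

Section inner_target.
Context {R : realType} {n : nat}.

Definition step_size (L : R) : R := ln ((2 * L + 1) / (2 * L)) / 2.

Definition inner_potential (f : R -> 'rV[R]_n -> R) (eta : R) (K k : nat)
    (x0 z : 'rV[R]_n) : R :=
  f ((K - k - 1)%N%:R * eta) z
  + norm2 (x0 - expR (- eta) *: z) ^+ 2 / (2 * (1 - expR (- 2 * eta))).

End inner_target.

(* Main.v *)
Require Import Defs.
From HB Require Import structures.
From mathcomp Require Import all_boot all_order all_algebra.
From mathcomp Require Import all_classical all_reals all_analysis.
From mathcomp Require Import measurable_realfun ring lra.
Set Implicit Arguments.
Unset Strict Implicit.
Unset Printing Implicit Defensive.
Import Order.TTheory GRing.Theory Num.Theory.
Import numFieldNormedType.Exports.
Local Open Scope classical_set_scope.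
Local Open Scope ring_scope.

(** The quadratic term of [g] has Hessian [e^{-2 eta} / (1 - e^{-2 eta}) I],
    and the choice of [eta] makes this [2 L I]. Since [f_t] differs from
    [- ln p_t] by a constant, its gradient is [L]-Lipschitz, so [f_t] is convex
    up to the defect [- L / 2 * norm2 _ ^+ 2] and [L]-smooth. Adding the moduli
    gives [- L + 2 L = L] and [L + 2 L = 3 L]. The quadratic term is nonnegative, so
    [e^{- g}] is dominated by a multiple of the probability density [p_t] and
    [gibbs g] is a genuine density, with [- ln (gibbs g)] equal to [g] up to a
    constant. *)

(** * Inner product and Euclidean norm *)

Section euclidean_theory.
Context {R : realType} {n : nat}.
Implicit Types (u v w x y : 'rV[R]_n) (f g : 'rV[R]_n -> R).

Definition dot u v : R := \sum_i u ord0 i * v ord0 i.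

Lemma dotC u v : dot u v = dot v u.
Proof. by apply: eq_bigr => i _; rewrite mulrC. Qed.

Lemma dotDl u v w : dot (u + v) w = dot u w + dot v w.
Proof. by rewrite -big_split; apply: eq_bigr => i _; rewrite mxE mulrDl. Qed.

Lemma dotZl a u v : dot (a *: u) v = a * dot u v.
Proof. by rewrite mulr_sumr; apply: eq_bigr => i _; rewrite mxE mulrA. Qed.

Lemma dotDr u v w : dot w (u + v) = dot w u + dot w v.
Proof. by rewrite !(dotC w) dotDl. Qed.

Lemma dotZr a u v : dot u (a *: v) = a * dot u v.
Proof. by rewrite !(dotC u) dotZl. Qed.

Lemma dotNl u v : dot (- u) v = - dot u v.
Proof. by rewrite -scaleN1r dotZl mulN1r. Qed.

Lemma dotNr u v : dot u (- v) = - dot u v.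
Proof. by rewrite !(dotC u) dotNl. Qed.

Definition dotE := (dotDl, dotDr, dotZl, dotZr, dotNl, dotNr).

Lemma dot_ge0 v : 0 <= dot v v.
Proof. by apply: sumr_ge0 => i _; rewrite -expr2 sqr_ge0. Qed.

Lemma norm2_ge0 v : 0 <= norm2 v.
Proof. exact: sqrtr_ge0. Qed.

Lemma sqr_norm2 v : norm2 v ^+ 2 = dot v v.
Proof.
by rewrite sqr_sqrtr ?sumr_ge0// => i _; rewrite sqr_ge0.
Qed.

Lemma norm2E v : norm2 v = Num.sqrt (dot v v).
Proof. by rewrite -sqr_norm2 sqrtr_sqr ger0_norm// norm2_ge0. Qed.

Lemma norm2Z a v : norm2 (a *: v) = `|a| * norm2 v.
Proof.
by rewrite !norm2E !dotE mulrA -expr2 sqrtrM ?sqr_ge0// sqrtr_sqr.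
Qed.

Lemma norm2N v : norm2 (- v) = norm2 v.
Proof. by rewrite -scaleN1r norm2Z normrN1 mul1r. Qed.

Lemma norm2_eq0 v : norm2 v = 0 -> v = 0.
Proof.
move=> v0; have /eqP : dot v v = 0 by rewrite -sqr_norm2 v0 expr0n.
rewrite psumr_eq0 => [/allP v0'|i _]; last by rewrite -expr2 sqr_ge0.
apply/rowP => i; rewrite mxE; apply/eqP.
by have := v0' i (mem_index_enum i); rewrite mulf_eq0 orbb.
Qed.

Lemma cauchy_schwarz u v : dot u v <= norm2 u * norm2 v.
Proof.
have [/norm2_eq0 ->|u0] := eqVneq (norm2 u) 0.
  by rewrite -(scale0r 0) dotZl mul0r mulr_ge0 ?norm2_ge0.
have [/norm2_eq0 ->|v0] := eqVneq (norm2 v) 0.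
  by rewrite -(scale0r 0) dotZr mul0r mulr_ge0 ?norm2_ge0.
have uv_gt0 : 0 < norm2 u * norm2 v.
  by rewrite mulr_gt0// lt0r norm2_ge0 ?u0 ?v0.
(* With [N = norm2 u * norm2 v], this square expands to [2 * N * (N - dot u v)], and [N] is positive
   here. *)
have := dot_ge0 (norm2 v *: u - norm2 u *: v).
rewrite !dotE -!sqr_norm2 (dotC v u) => H.
by rewrite -(ler_pM2l uv_gt0); nra.
Qed.

Lemma norm2D u v : norm2 (u + v) <= norm2 u + norm2 v.
Proof.
rewrite -(ler_pXn2r (n := 2))// ?nnegrE ?addr_ge0 ?norm2_ge0//.
rewrite sqrrD !sqr_norm2 !dotE (dotC v u).
have := cauchy_schwarz u v; lra.
Qed.

(** * Derivatives along lines *)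

Lemma derive_dot_grad f x v : differentiable f x -> 'D_v f x = dot v (grad f x).
Proof.
move=> df; rewrite deriveE// [in LHS](row_sum_delta v) raddf_sum.
by apply: eq_bigr => i _; rewrite /= linearZ /= mxE deriveE.
Qed.

(** The difference quotient of the restriction at [t] is literally that of [f] at [y + t *: v] in
    direction [v]. *)
Lemma is_derive_line f y v (t : R) : differentiable f (y + t *: v) ->
  is_derive t 1 (fun s => f (y + s *: v)) (dot v (grad f (y + t *: v))).
Proof.
move=> df; rewrite -derive_dot_grad//.
have lineE : (fun h : R =>
      h^-1 *: (((fun s => f (y + s *: v)) \o shift t) (h *: 1)
        - f (y + t *: v))) =
    (fun h : R => h^-1 *:
      ((f \o shift (y + t *: v)) (h *: v) - f (y + t *: v))).
  apply/funext => h /=; congr (_ *: (f _ - _)).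
  by rewrite scalerDl addrCA [_ *: 1]mulr1.
split.
- by rewrite /derivable lineE; exact: diff_derivable.
- by rewrite /derive lineE.
Qed.

(** * Moduli of convexity and smoothness under sums, signs and constants *)

Lemma strongly_convexD (m1 m2 : R) f g :
  strongly_convex m1 f -> strongly_convex m2 g ->
  strongly_convex (m1 + m2) (fun x => f x + g x).
Proof.
move=> cf cg x y a a01; have := cf x y a a01; have := cg x y a a01; lra.
Qed.

Lemma strongly_convex_cst (c : R) : strongly_convex 0 (cst c : 'rV[R]_n -> R).
Proof. by move=> x y a _; lra. Qed.

Lemma smoothD (L M : R) f g :
  smooth L f -> smooth M g -> smooth (L + M) (fun x => f x + g x).
Proof.
move=> [df Lf] [dg Lg].
have gradD x : grad (fun x => f x + g x) x = grad f x + grad g x.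
  apply/rowP => i; rewrite !mxE.
  by rewrite (@deriveD _ _ _ f g)//; exact: diff_derivable.
split=> [x|x y]; first exact: (@differentiableD _ _ _ f g).
rewrite !gradD opprD addrACA (le_trans (norm2D _ _))// mulrDl lerD//.
Qed.

Lemma smoothN (L : R) f : smooth L f -> smooth L (fun x => - f x).
Proof.
move=> [df Lf].
have gradN x : grad (fun x => - f x) x = - grad f x.
  by apply/rowP => i; rewrite !mxE (@deriveN _ _ _ f)//; exact: diff_derivable.
split=> [x|x y]; first exact: (@differentiableN _ _ _ f).
by rewrite !gradN -opprD norm2N.
Qed.

Lemma smooth_cst (c : R) : smooth 0 (cst c : 'rV[R]_n -> R).
Proof.
split=> [x|x y]; first exact: differentiable_cst.
rewrite mul0r (_ : _ - _ = 0); last first.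
  by apply/rowP => i; rewrite !mxE !(@derive_cst _ _ _ c) subrr.
by rewrite -(scale0r 0) norm2Z normr0 mul0r.
Qed.

(** * Weak convexity from a Lipschitz gradient *)

Lemma convex_derive_homo (h dh : R -> R) :
  (forall t : R, is_derive t (1 : R) h (dh t)) -> {homo dh : s t / s <= t} ->
  forall a, 0 <= a <= 1 -> h a <= a * h 1 + (1 - a) * h 0.
Proof.
move=> hdh dh_homo a /andP[a_ge0 a_le1].
have hcont (s t : R) : {within `[s, t], continuous h}.
  apply: derivable_within_continuous => r _; exact: ex_derive.
have [c1 /itvP c1a e1] := MVT_segment a_ge0 (fun t _ => hdh t) (@hcont _ _).
have [c2 /itvP c2a e2] := MVT_segment a_le1 (fun t _ => hdh t) (@hcont _ _).
have c12 : dh c1 <= dh c2.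
  by apply: dh_homo; rewrite (le_trans (y := a)) ?c1a ?c2a.
(* By [e1] and [e2], this product equals the convexity gap [a * h 1 + (1 - a) * h 0 - h a]. *)
have : 0 <= a * (1 - a) * (dh c2 - dh c1).
  by rewrite !mulr_ge0 ?subr_ge0.
nra.
Qed.

(* Along a segment, [L / 2 * norm2 _ ^+ 2] adds to the directional derivative
   of [f] enough slope to make it monotone. *)
Lemma smooth_weakly_convex (L : R) f : smooth L f -> strongly_convex (- L) f.
Proof.
move=> [df Lf] x y a a01.
set v := x - y; set D := norm2 v ^+ 2.
pose h (t : R) := f (y + t *: v) + L * D / 2 * t ^+ 2.
pose dh (t : R) := dot v (grad f (y + t *: v)) + L * D * t.
have hdh (t : R) : is_derive t 1 h (dh t).
  have ? := is_derive_line (df (y + t *: v)).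
  by apply: is_derive_eq; rewrite /dh /GRing.scale/=; field.
have dh_homo : {homo dh : s t / s <= t}.
  move=> s t st; rewrite /dh -subr_ge0.
  set gs := grad f (y + s *: v); set gt := grad f (y + t *: v).
  have : dot v (gs - gt) <= norm2 v * (L * ((t - s) * norm2 v)).
    apply: (le_trans (cauchy_schwarz _ _)).
    apply: ler_wpM2l; first exact: norm2_ge0.
    apply: (le_trans (Lf _ _)); rewrite opprD addrACA subrr add0r -scalerBl.
    by rewrite norm2Z distrC ger0_norm ?subr_ge0.
  rewrite !dotE /D; lra.
(* The quadratic correction contributes [L * D / 2 * (a - a ^+ 2)], which is exactly the allowed
   defect. *)
have := convex_derive_homo hdh dh_homo a01.
rewrite /h scale1r scale0r addr0 expr1n expr0n/= /v subrKC.
have -> : a *: x + (1 - a) *: y = y + a *: (x - y).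
  by rewrite scalerBl scalerBr scale1r addrCA addrA addrAC -addrA addrC.
rewrite -/v -/D; lra.
Qed.

(** * The quadratic term, with Hessian [2 * a * b ^+ 2] times the identity *)

Definition sqdist (a b : R) x0 x : R := a * norm2 (x0 - b *: x) ^+ 2.

(** For a quadratic the inequality is an identity between polynomials in inner products. *)
Lemma strongly_convex_sqdist (a b : R) x0 :
  strongly_convex (2 * a * b ^+ 2) (sqdist a b x0).
Proof.
move=> x y t _; rewrite /sqdist !sqr_norm2 !dotE !(dotC _ x0) (dotC y x); lra.
Qed.

Lemma is_diff_coord (i : 'I_n) x :
  is_diff x (fun z : 'rV[R]_n => z ord0 i) (fun z : 'rV[R]_n => z ord0 i).
Proof.
pose l := (fun z : 'rV[R]_n => z ord0 i).
have l_lin : linear l by move=> c u v; rewrite /l !mxE.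
pose L := GRing.isLinear.Build R _ _ _ l l_lin.
pose l' : {linear 'rV[R]_n -> R} := HB.pack l L.
split; first exact: differentiable_coord.
exact: (@diff_lin _ _ _ l' x (@coord_continuous _ _ _ _ _)).
Qed.

(** Written in the algebra of functions, the term is open to the rules for differentiability,
    derivatives and measurability. *)
Lemma sqdistE (a b : R) x0 : sqdist a b x0 = a *: (\sum_(i < n)
   (cst (x0 ord0 i) - b *: (fun z : 'rV[R]_n => z ord0 i)) ^+ 2).
Proof.
apply/funext => z; rewrite /sqdist sqr_norm2 /dot fctE fct_sumE; congr (_ * _).
by apply: eq_bigr => i _; rewrite !mxE expr2.
Qed.

Lemma differentiable_sqdist (a b : R) x0 x : differentiable (sqdist a b x0) x.
Proof.
rewrite sqdistE; apply: differentiableZ; apply: differentiable_sum => i.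
apply: differentiableX; apply: differentiableB => //.
by apply: differentiableZ; exact: differentiable_coord.
Qed.

Lemma grad_sqdist (a b : R) x0 x :
  grad (sqdist a b x0) x = (2 * a * b) *: (b *: x - x0).
Proof.
apply/rowP => j; rewrite !mxE; set v := delta_mx _ _.
have dcoord i : is_derive x v (fun z : 'rV[R]_n => z ord0 i) (v ord0 i).
  have [dl le] := is_diff_coord i x.
  by split; [exact: diff_derivable|rewrite deriveE// le].
have dsum : is_derive x v (sqdist a b x0) (a *: \sum_(i < n)
    (2 * (x0 ord0 i - b * x ord0 i) * - (b * v ord0 i))).
  rewrite sqdistE; apply: is_deriveZ; apply: is_derive_sum => i.
  by apply: is_derive_eq; rewrite sub0r /GRing.scale/= expr1.
(* Since [v] is the [j]-th basis vector, only the summand [j] survives. *)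
rewrite derive_val (bigD1 j)//= big1 => [|i ij].
  rewrite !mxE !eqxx/= /GRing.scale/=; ring.
by rewrite !mxE (negbTE ij) !mulr0 oppr0 mulr0.
Qed.

Lemma smooth_sqdist (a b : R) x0 :
  0 <= a -> smooth (2 * a * b ^+ 2) (sqdist a b x0).
Proof.
move=> a_ge0; split=> [x|x y]; first exact: differentiable_sqdist.
rewrite !grad_sqdist -scalerBr opprB addrA subrK -scalerBr scalerA.
rewrite norm2Z ger0_norm -?mulrA -?expr2//.
by rewrite mulr_ge0 // mulr_ge0 ?sqr_ge0.
Qed.

End euclidean_theory.

(** * Finiteness and positivity of the normalizing integral *)

Section normalization.
Context {d} {T : measurableType d} {R : realType}.
Variable mu : {measure set T -> \bar R}.

(* Positivity: if the integral vanished, [expR (- g _)] would be null almost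
   everywhere, so [setT] would be negligible and [p] could not integrate to 1. *)
Lemma Rintegral_expRN_gt0 (p g : T -> R) (C : R) :
  measurable_fun [set: T] p -> measurable_fun [set: T] g ->
  (forall x, 0 <= p x) -> (\int[mu]_x (p x)%:E = 1)%E ->
  (forall x, expR (- g x) <= C * p x) ->
  0 < \int[mu]_(x in [set: T]) expR (- g x).
Proof.
move=> mp mg p_ge0 p1 gp.
have mexp : measurable_fun [set: T] (fun x => expR (- g x)).
  by apply: measurableT_comp => //; exact: measurableT_comp.
have mexpE : measurable_fun [set: T] (EFin \o (fun x => expR (- g x))).
  exact/measurable_EFinP.
have mpE : measurable_fun [set: T] (EFin \o p) by exact/measurable_EFinP.
have ip : mu.-integrable [set: T] (EFin \o p).
  apply/integrableP; split=> //=.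
  under eq_integral do rewrite ger0_norm//.
  by rewrite p1 ltry.
have ig : mu.-integrable [set: T] (EFin \o (fun x => expR (- g x))).
  apply: (@le_integrable _ _ _ _ _ measurableT _
    (fun x => (C%:E * (p x)%:E)%E)) => //.
    move=> x _; rewrite /= lee_fin ger0_norm ?expR_ge0//.
    by rewrite (le_trans (gp x))// ler_norm.
  exact: (@integrableZl _ _ _ _ _ measurableT _ _ ip).
(* Finiteness matters because [fine] would send an infinite integral to 0. *)
have fing : (\int[mu]_x (expR (- g x))%:E)%E \is a fin_num.
  exact: integrable_fin_num.
have g_ge0 : (0 <= \int[mu]_x (expR (- g x))%:E)%E.
  by apply: integral_ge0 => x _; rewrite lee_fin expR_ge0.
rewrite /Rintegral lt_def fine_ge0// andbT fine_eq0//; apply/eqP => g0.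
have /(ae_eq_integral_abs mu measurableT mexpE) aeg :
    (\int[mu]_x `|(expR (- g x))%:E|)%E = 0%E.
  by under eq_integral do rewrite gee0_abs ?lee_fin ?expR_ge0//.
have /(ae_eq_integral_abs mu measurableT mpE) :
    ae_eq mu setT (EFin \o p) (cst 0%E).
  apply: filterS aeg => x /= /(_ Logic.I) [] /eqP.
  by rewrite gt_eqF// expR_gt0.
under eq_integral do rewrite /= ger0_norm//.
by rewrite p1 => /eqP; rewrite onee_eq0.
Qed.

End normalization.

(** * Gibbs densities and the choice of step size *)

Section gibbs_theory.
Context {R : realType} {n : nat}.
Implicit Types (f g p : 'rV[R]_n -> R) (x : 'rV[R]_n).

Lemma measurable_sqdist (a b : R) x0 :
  measurable_fun [set: 'rV[R]_n] (sqdist a b x0).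
Proof.
rewrite sqdistE; apply: measurable_funM => //.
rewrite fct_sumE; apply: measurable_sum => i.
apply: (measurable_funX (f := fun z : 'rV[R]_n => x0 ord0 i - b * z ord0 i) 2).
apply: measurable_funB => //.
by apply: measurable_funM => //; exact: measurable_rV_coord.
Qed.

(** Minus the log-density is [g] plus the constant [ln Z], which changes neither modulus. *)
Lemma gibbs_log_regular (m M : R) g :
  0 < \int[lebesgue_measure_rV R n]_(y in [set: 'rV[R]_n]) expR (- g y) ->
  strongly_convex m g -> smooth M g ->
  strongly_log_concave m (gibbs g) /\ log_smooth M (gibbs g).
Proof.
rewrite /strongly_log_concave /log_smooth /gibbs.
set Z := Rintegral _ _ _ => Z_gt0 cg sg.
have gibbs_gt0 x : 0 < expR (- g x) / Z by rewrite divr_gt0 ?expR_gt0.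
have -> : (fun x => - ln (expR (- g x) / Z)) = (fun x => g x + cst (ln Z) x).
  apply/funext => x; rewrite lnM ?posrE ?expR_gt0 ?invr_gt0//.
  by rewrite lnV ?posrE// expRK opprB opprK addrC.
split; split=> //.
  rewrite -[m]addr0; apply: strongly_convexD => //.
  exact: strongly_convex_cst.
by rewrite -[M]addr0; apply: smoothD => //; exact: smooth_cst.
Qed.

(** Carries the regularity of [ln p], which is what the score hypothesis controls, over to the
    potential [f]. *)
Lemma propto_exp_potentialE p f : propto_exp p f ->
  exists c : R, f = (fun x => - ln (p x) + cst c x).
Proof.
move=> [c c_gt0 pE]; exists (ln c); apply/funext => x.
by rewrite /= pE lnM ?posrE ?expR_gt0// expRK; lra.
Qed.

Lemma step_size_exp (L : R) : 0 < L ->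
  expR (- 2 * step_size L) = 2 * L / (2 * L + 1).
Proof.
move=> L_gt0; rewrite /step_size mulNr mulrC divfK// expRN lnK ?invf_div//.
by rewrite posrE divr_gt0//; lra.
Qed.

(** Here [1 - expR (- 2 * eta)] is the inverse of [2 * L + 1], whence the coefficient
    [(2 * L + 1) / 2]. *)
Lemma inner_potentialE (f : R -> 'rV[R]_n -> R) (L : R) K k x0 : 0 < L ->
  inner_potential f (step_size L) K k x0 =
  (fun z => f ((K - k - 1)%N%:R * step_size L) z +
    sqdist ((2 * L + 1) / 2) (expR (- step_size L)) x0 z).
Proof.
move=> L_gt0; apply/funext => z; rewrite /inner_potential /sqdist.
rewrite step_size_exp//; congr (_ + _); field.
by apply/andP; split; rewrite gt_eqF//; lra.
Qed.

End gibbs_theory.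

Theorem lemmaC1 (R : realType) (d : nat)
    (disp : measure_display) (Omega : measurableType disp)
    (P : probability Omega R)
    (pstar fstar : 'rV[R]_d -> R)
    (F : R -> set (set Omega)) (B X : R -> Omega -> 'rV[R]_d)
    (p f : R -> 'rV[R]_d -> R)
    (L : R) (K k : nat)
    (pstarE : propto_exp pstar fstar)
    (X0_pstar : has_density P (X 0) pstar)
    (X_OU : ornstein_uhlenbeck P F B X)
    (ptE : forall t, 0 <= t -> propto_exp (p t) (f t))
    (Xt_pt : forall t, 0 <= t -> has_density P (X t) (p t))
    (L_gt0 : 0 < L)
    (A1 : forall t, 0 <= t -> score_lipschitz L (p t))
    (K_ge1 : (1 <= K)%N) (k_ltK : (k < K)%N)
    (x0 : 'rV[R]_d) :
  let g := inner_potential f (step_size L) K k x0 in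
  [/\ strongly_log_concave L (gibbs g),
      log_smooth (3 * L) (gibbs g),
      strongly_convex L g &
      smooth (3 * L) g].
Proof.
set t := (K - k - 1)%N%:R * step_size L.
(* The step size is the logarithm of a ratio at least 1, halved, so the hypotheses on nonnegative
   times apply at [t]. *)
have t_ge0 : 0 <= t.
  rewrite mulr_ge0// divr_ge0// ln_ge0// ler_pdivlMr; lra.
have curv : 2 * ((2 * L + 1) / 2) * expR (- step_size L) ^+ 2 = 2 * L.
  rewrite -expRM_natl mulrN -mulNr step_size_exp//; field.
  by lra.
have [c fE] := propto_exp_potentialE (ptE t t_ge0).
have f_smooth : smooth L (f t).
  rewrite fE -[L]addr0; apply: smoothD; last exact: smooth_cst.
  (* Unfolding [score] turns [score_lipschitz L (p t)] into [smooth L] for the log-density. *)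
  exact/smoothN/A1.
move=> g; rewrite {}/g inner_potentialE// -/t.
set q := sqdist _ _ x0.
have g_convex : strongly_convex L (fun z => f t z + q z).
  have -> : L = - L + 2 * L by lra.
  apply: strongly_convexD; first exact: smooth_weakly_convex.
  by rewrite -curv; exact: strongly_convex_sqdist.
have g_smooth : smooth (3 * L) (fun z => f t z + q z).
  have -> : 3 * L = L + 2 * L by lra.
  apply: smoothD => //; rewrite -curv; apply: smooth_sqdist; lra.
have [_ mp p_ge0 pP] := Xt_pt t t_ge0.
have [c' c'_gt0 pE] := ptE t t_ge0.
have Z_gt0 : 0 < \int[lebesgue_measure_rV R d]_(y in [set: 'rV[R]_d])
    expR (- (f t y + q y)).
  (* From [p t = c' * expR (- f t)] and [0 <= q], the integrand is at most [c'^-1 * p t]. *)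
  apply: (@Rintegral_expRN_gt0 _ _ _ _ (p t) _ c'^-1) => //.
  - apply: measurable_funD; last exact: measurable_sqdist.
    (* Measurability of the potential comes from that of the density through [ln]. *)
    rewrite fE; apply: measurable_funD => //.
    by apply: measurableT_comp => //; exact: measurableT_comp.
  - by rewrite -pP// preimage_setT probability_setT.
  - move=> x; rewrite pE mulKf ?gt_eqF// ler_expR lerN2 lerDl.
    by rewrite mulr_ge0 ?sqr_ge0//; lra.
by have [] := gibbs_log_regular Z_gt0 g_convex g_smooth.
Qed.
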